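(* Let $M$ be a $\Sigma$-H-structure in a Heyting category $\mathbb C$, where $\Sigma$ is a logical signature. If $\phi\vdash_{\vec x}\psi$ is a sequent in the language over $\Sigma$, then $\phi\vdash_{\vec x}\psi$ is valid in $M$ if and only if $\phi\vdash_{\vec x}\psi$ is valid in $\mathrm{LD}(M)$.
   Context: **Syntax.** A logical signature $\Sigma=\langle S,F,R\rangle$ consists of sorts, function symbols $f\colon s_1\times\cdots\times s_n\to s_0$ and relation symbols $r\colon s_1\times\cdots\times s_n$; each sort has denumerably many variables. Logical formulae are generated from sorted first-order terms by $\top$, $\bot$, $r(t_1,\dots,t_n)$, $\wedge,\vee,\supset$, $\forall x{:}s.\,A$, $\exists x{:}s.\,A$; $\mathrm{FV}$ denotes free variables. A sequent $\phi\vdash_{\vec x}\psi$ consists of formulae $\phi,\psi$ and a context $\vec x=x_1:A_1,\dots,x_n:A_n$ with $\mathrm{FV}(\phi)\cup\mathrm{FV}(\psi)\subseteq\vec x$. **Heyting semantics.** A Heyting category $\mathbb C$ is a coherent category (regular, with finite joins of sub-objects stable under pullback) in which every pullback functor $f^*\colon\mathrm{Sub}_{\mathbb C}(b)\to\mathrm{Sub}_{\mathbb C}(a)$, $f\colon a\to b$, has a right adjoint $\forall_f$; it always has a left adjoint $\exists_f$, and each $\mathrm{Sub}_{\mathbb C}(a)$ is (up to isomorphisms) a Heyting algebra. A $\Sigma$-H-structure $M$ in $\mathbb C$ assigns to each sort $A$ an object $MA$, to each function symbol $f\colon A_1\times\cdots\times A_n\to B$ an arrow $Mf\colon MA_1\times\cdots\times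 MA_n\to MB$, and to each relation symbol $R\colon A_1\times\cdots\times A_n$ a sub-object $MR\rightarrowtail MA_1\times\cdots\times MA_n$. For a context $\vec x=x_1:A_1,\dots,x_n:A_n$ put $M\vec x=MA_1\times\cdots\times MA_n$ (terminal object if $\vec x$ is empty). Terms in context: $[\![\vec x.\,x_i]\!]=\pi_i$, $[\![\vec x.\,f(t_1,\dots,t_m)]\!]=Mf\circ([\![\vec x.\,t_1]\!],\dots,[\![\vec x.\,t_m]\!])$. Formulae in context are interpreted as sub-objects $[\![\vec x.\phi]\!]$ of $M\vec x$: $[\![\vec x.\,R(t_1,\dots,t_m)]\!]$ is the pullback of $MR$ along $([\![\vec x.\,t_1]\!],\dots,[\![\vec x.\,t_m]\!])$; $\top,\bot,\wedge,\vee,\supset$ are interpreted by the corresponding Heyting algebra operations of $\mathrm{Sub}_{\mathbb C}(M\vec x)$; $[\![\vec x.\,\exists y{:}s.\,\psi]\!]=\exists_\pi[\![\vec x,y:s.\,\psi]\!]$ and $[\![\vec x.\,\forall y{:}s.\,\psi]\!]=\forall_\pi[\![\vec x,y:s.\,\psi]\!]$ with $\pi\colon M\vec x\times Ms\to M\vec x$ the projection. The sequent $\phi\vdash_{\vec x}\psi$ is valid in $M$ when $[\![\vec x.\phi]\!]\le[\![\vec x.\psi]\!]$ in $\mathrm{Sub}_{\mathbb C}(M\vec x)$. **$\mathrm{LD}(M)=\langle\mathbb D,N\rangle$** is the logically distributive category associated with $M$: the objects of $\mathbb D$ are $[\![\mathrm{FV}(\phi).\phi]\!]_{\mathbb C}$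 for every logical formula $\phi$ over $\Sigma$; $\mathrm{Hom}_{\mathbb D}([\![\mathrm{FV}(\phi).\phi]\!],[\![\mathrm{FV}(\psi).\psi]\!])$ contains at most one arrow, and it contains one exactly when $[\![\mathrm{FV}(\phi)\cup\mathrm{FV}(\psi).\phi]\!]\le[\![\mathrm{FV}(\phi)\cup\mathrm{FV}(\psi).\psi]\!]$ in $\mathrm{Sub}_{\mathbb C}(M(\mathrm{FV}(\phi)\cup\mathrm{FV}(\psi)))$; identities and composition come from reflexivity and transitivity of $\le$; $N$ maps each formula $\phi$ to $[\![\mathrm{FV}(\phi).\phi]\!]$. The sequent $\phi\vdash_{\vec x}\psi$ is valid in $\mathrm{LD}(M)$ when there is an arrow $N\phi\to N\psi$ in $\mathbb D$.
   Formalization: That LD(M) is a logically distributive category is assumed of M: it fails if a sort is interpreted by an empty object, and then the claim is false (MA empty: ⊤ ⊢_{x:A} ⊥ is valid in M, not in LD(M)). Equality of sorts is taken to be decidable. *)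

(* Defs.v *)
From mathcomp Require Import all_boot.
From Stdlib Require Import ProofIrrelevance.

Set Implicit Arguments.
Unset Strict Implicit.
Unset Printing Implicit Defensive.

(** * Categories *)

Record category := Category {
  obj :> Type;
  hom : obj -> obj -> Type;
  idc : forall a, hom a a;
  cmp : forall a b c, hom b c -> hom a b -> hom a c;
  cmp1c : forall a b (f : hom a b), cmp (idc b) f = f;
  cmpc1 : forall a b (f : hom a b), cmp f (idc a) = f;
  cmpA : forall a b c d (f : hom c d) (g : hom b c) (h : hom a b),
    cmp f (cmp g h) = cmp (cmp f g) h }.

Arguments idc {_} a.
Infix "\oc" := cmp (at level 40, left associativity).

Definition is_iso (C : category) (a b : C) (f : hom a b) : Prop :=
  exists g : hom b a, g \oc f = idc a /\ f \oc g = idc b.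

Definition isom (C : category) (a b : C) : Prop := exists f : hom a b, is_iso f.

Definition mono (C : category) (a b : C) (f : hom a b) : Prop :=
  forall c (g h : hom c a), f \oc g = f \oc h -> g = h.

Record products (C : category) := Products {
  one : C;
  bang : forall a, hom a one;
  bang_uniq : forall a (f g : hom a one), f = g;
  prd : C -> C -> C;
  pfst : forall a b, hom (prd a b) a;
  psnd : forall a b, hom (prd a b) b;
  ppair : forall c a b, hom c a -> hom c b -> hom c (prd a b);
  pfst_pair : forall c a b (f : hom c a) (g : hom c b),
    pfst a b \oc ppair f g = f;
  psnd_pair : forall c a b (f : hom c a) (g : hom c b),
    psnd a b \oc ppair f g = g;
  ppair_uniq : forall c a b (f g : hom c (prd a b)),
    pfst a b \oc f = pfst a b \oc g -> psnd a b \oc f = psnd a b \oc g ->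
    f = g }.

Record coproducts (C : category) := Coproducts {
  zero : C;
  cobang : forall a, hom zero a;
  cobang_uniq : forall a (f g : hom zero a), f = g;
  cprd : C -> C -> C;
  inj1 : forall a b, hom a (cprd a b);
  inj2 : forall a b, hom b (cprd a b);
  copair : forall a b c, hom a c -> hom b c -> hom (cprd a b) c;
  copair_inj1 : forall a b c (f : hom a c) (g : hom b c),
    copair f g \oc inj1 a b = f;
  copair_inj2 : forall a b c (f : hom a c) (g : hom b c),
    copair f g \oc inj2 a b = g;
  copair_uniq : forall a b c (f g : hom (cprd a b) c),
    f \oc inj1 a b = g \oc inj1 a b -> f \oc inj2 a b = g \oc inj2 a b ->
    f = g }.

Definition prd_map (C : category) (P : products C) (a a' b b' : C)
  (f : hom a a') (g : hom b b') : hom (prd P a b) (prd P a' b') :=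
  ppair P (f \oc pfst P a b) (g \oc psnd P a b).

Record exponentials (C : category) (P : products C) := Exponentials {
  expo : C -> C -> C;
  eval : forall a b, hom (prd P (expo a b) a) b;
  curry : forall a b c, hom (prd P c a) b -> hom c (expo a b);
  eval_curry : forall a b c (f : hom (prd P c a) b),
    eval a b \oc prd_map P (curry f) (idc a) = f;
  curry_uniq : forall a b c (f g : hom c (expo a b)),
    eval a b \oc prd_map P f (idc a) = eval a b \oc prd_map P g (idc a) ->
    f = g }.

Record pullbacks (C : category) := Pullbacks {
  pb : forall a b c : C, hom a c -> hom b c -> C;
  pb1 : forall (a b c : C) (f : hom a c) (g : hom b c), hom (pb f g) a;
  pb2 : forall (a b c : C) (f : hom a c) (g : hom b c), hom (pb f g) b;
  pb_comm : forall (a b c : C) (f : hom a c) (g : hom b c),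
    f \oc pb1 f g = g \oc pb2 f g;
  pb_ex : forall (a b c d : C) (f : hom a c) (g : hom b c)
    (h : hom d a) (k : hom d b), f \oc h = g \oc k ->
    exists u : hom d (pb f g), pb1 f g \oc u = h /\ pb2 f g \oc u = k;
  pb_uniq : forall (a b c d : C) (f : hom a c) (g : hom b c)
    (u v : hom d (pb f g)),
    pb1 f g \oc u = pb1 f g \oc v -> pb2 f g \oc u = pb2 f g \oc v -> u = v }.

(** * Sub-objects

    A sub-object is given by a representing monomorphism; two sub-objects are
    identified when each is below the other. *)

Record sub (C : category) (a : C) := Sub {
  sdom : C;
  smap : hom sdom a;
  smap_mono : mono smap }.

Definition factors (C : category) (a b : C) (f : hom a b) (m : sub b) : Prop :=
  exists g : hom a (sdom m), smap m \oc g = f.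

Definition sub_le (C : category) (a : C) (m n : sub a) : Prop :=
  factors (smap m) n.

Lemma sub_le_refl (C : category) (a : C) (m : sub a) : sub_le m m.
Proof. by exists (idc _); rewrite cmpc1. Qed.

Lemma sub_le_trans (C : category) (a : C) (m n p : sub a) :
  sub_le m n -> sub_le n p -> sub_le m p.
Proof. by move=> [f ef] [g eg]; exists (g \oc f); rewrite cmpA eg. Qed.

Lemma idc_mono (C : category) (a : C) : mono (idc a).
Proof. by move=> c g h; rewrite !cmp1c. Qed.

Lemma cmp_mono (C : category) (a b c : C) (f : hom b c) (g : hom a b) :
  mono f -> mono g -> mono (f \oc g).
Proof. by move=> mf mg d h k; rewrite -!cmpA => /mf/mg. Qed.

Definition sub_top (C : category) (a : C) : sub a := Sub (@idc_mono C a).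

(* A cover factors through no proper sub-object of its codomain. *)
Definition cover (C : category) (a b : C) (f : hom a b) : Prop :=
  forall m : sub b, factors f m -> sub_le (sub_top b) m.

Section Pullback.
Variables (C : category) (PB : pullbacks C).

Lemma pb1_mono (a b : C) (f : hom a b) (m : sub b) : mono (pb1 PB f (smap m)).
Proof.
move=> d u v e; apply: (pb_uniq e); apply: (smap_mono (s := m)).
by rewrite !cmpA -pb_comm -!cmpA e.
Qed.

Definition sub_pb (a b : C) (f : hom a b) (m : sub b) : sub a :=
  Sub (@pb1_mono a b f m).

Definition sub_meet (a : C) (m n : sub a) : sub a :=
  Sub (cmp_mono (smap_mono (s := m)) (smap_mono (s := sub_pb (smap m) n))).

End Pullback.

(** * Heyting categories *)

Record heyting_category := HeytingCategory {
  hcat :> category;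
  hprod : products hcat;
  hpb : pullbacks hcat;
  image : forall (a b : hcat), hom a b -> sub b;
  image_factors : forall (a b : hcat) (f : hom a b), factors f (image f);
  image_least : forall (a b : hcat) (f : hom a b) (m : sub b),
    factors f m -> sub_le (image f) m;
  cover_pb : forall (a b c : hcat) (f : hom a c) (g : hom b c),
    cover f -> cover (pb2 hpb f g);
  sub_bot : forall a : hcat, sub a;
  sub_bot_least : forall (a : hcat) (m : sub a), sub_le (sub_bot a) m;
  sub_join : forall a : hcat, sub a -> sub a -> sub a;
  sub_join_lub : forall (a : hcat) (m n p : sub a),
    sub_le (sub_join m n) p <-> sub_le m p /\ sub_le n p;
  sub_bot_pb : forall (a b : hcat) (f : hom a b),
    sub_le (sub_pb hpb f (sub_bot b)) (sub_bot a);
  sub_join_pb : forall (a b : hcat) (f : hom a b) (m n : sub b),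
    sub_le (sub_pb hpb f (sub_join m n))
           (sub_join (sub_pb hpb f m) (sub_pb hpb f n));
  sub_forall : forall a b : hcat, hom a b -> sub a -> sub b;
  sub_forall_adj : forall (a b : hcat) (f : hom a b) (m : sub a) (n : sub b),
    sub_le (sub_pb hpb f n) m <-> sub_le n (sub_forall f m) }.

Definition sub_exists (C : heyting_category) (a b : C) (f : hom a b)
  (m : sub a) : sub b := image (f \oc smap m).

(* The Heyting implication of Sub(a), obtained from the right adjoint of
   pulling back along a representing monomorphism. *)
Definition sub_imp (C : heyting_category) (a : C) (m n : sub a) : sub a :=
  sub_forall (smap m) (sub_pb (hpb C) (smap m) n).

Lemma factors_pb (C : category) (PB : pullbacks C) (a b c : C)
  (f : hom a b) (g : hom c a) (m : sub b) :
  factors g (sub_pb PB f m) <-> factors (f \oc g) m.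
Proof.
split=> [[u <-] | [u e]].
  by exists (pb2 PB f (smap m) \oc u); rewrite !cmpA pb_comm.
by have [v [v1 v2]] := pb_ex PB (esym e); exists v.
Qed.

Lemma factors_le (C : category) (a b : C) (f : hom a b) (m n : sub b) :
  factors f m -> sub_le m n -> factors f n.
Proof. by move=> [u <-] [v e]; exists (v \oc u); rewrite cmpA e. Qed.

Lemma sub_meet_glb (C : category) (PB : pullbacks C) (a : C) (m n p : sub a) :
  sub_le p (sub_meet PB m n) <-> sub_le p m /\ sub_le p n.
Proof.
split=> [[u e] | [[u e] pn]].
  split; first by exists (pb1 PB (smap m) (smap n) \oc u); rewrite cmpA.
  by exists (pb2 PB (smap m) (smap n) \oc u); rewrite cmpA -pb_comm.
have [v ev] : factors u (sub_pb PB (smap m) n).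
  by apply/factors_pb; rewrite e.
by exists v; rewrite -[RHS]e -ev /= !cmpA.
Qed.

Lemma sub_le_pb (C : category) (PB : pullbacks C) (a b : C) (f : hom a b)
  (m : sub a) (n : sub b) :
  sub_le m (sub_pb PB f n) <-> factors (f \oc smap m) n.
Proof. exact: factors_pb. Qed.

Lemma sub_exists_adj (C : heyting_category) (a b : C) (f : hom a b)
  (m : sub a) (n : sub b) :
  sub_le (sub_exists f m) n <-> sub_le m (sub_pb (hpb C) f n).
Proof.
split=> [le_n | /sub_le_pb]; last exact: image_least.
by apply/sub_le_pb; apply: factors_le le_n; apply: image_factors.
Qed.

Lemma sub_meetC (C : category) (PB : pullbacks C) (a : C) (m n : sub a) :
  sub_le (sub_meet PB m n) (sub_meet PB n m).
Proof.
have [h1 h2] := (sub_meet_glb PB m n _).1 (sub_le_refl _).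
by apply/sub_meet_glb.
Qed.

Lemma sub_imp_adj (C : heyting_category) (a : C) (m n p : sub a) :
  sub_le p (sub_imp m n) <-> sub_le (sub_meet (hpb C) p m) n.
Proof.
apply: iff_trans (iff_sym (sub_forall_adj _ _ _)) _.
split=> [/sub_le_pb H | H]; first exact: sub_le_trans (sub_meetC _ _ _) H.
by apply/sub_le_pb; apply: sub_le_trans (sub_meetC _ _ _) H.
Qed.

(** * Syntax *)

Record signature := Signature {
  sort : eqType;
  func : Type;
  fdom : func -> seq sort;
  fcod : func -> sort;
  rel_sym : Type;
  rdom : rel_sym -> seq sort }.

Arguments fdom {_} f.
Arguments fcod {_} f.
Arguments rdom {_} r.

(* [(s, n)] is the [n]-th variable of sort [s]. *)
Definition var (Sg : signature) : eqType := (sort Sg * nat)%type.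

Inductive term (Sg : signature) : sort Sg -> Type :=
  | Var (s : sort Sg) (n : nat) : term s
  | App (f : func Sg) (ts : terms (fdom f)) : term (fcod f)
with terms (Sg : signature) : seq (sort Sg) -> Type :=
  | TNil : terms [::]
  | TCons (s : sort Sg) (l : seq (sort Sg)) (t : term s) (ts : terms l) :
      terms (s :: l).

Arguments Var {Sg} s n.

Definition vterm (Sg : signature) (x : var Sg) : term x.1 := Var x.1 x.2.

Inductive formula (Sg : signature) : Type :=
  | Top
  | Bot
  | Rel (r : rel_sym Sg) (ts : terms (rdom r))
  | And (A B : formula Sg)
  | Or (A B : formula Sg)
  | Imp (A B : formula Sg)
  | All (x : var Sg) (A : formula Sg)
  | Ex (x : var Sg) (A : formula Sg).

Arguments Top {Sg}.
Arguments Bot {Sg}.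

Fixpoint tFV (Sg : signature) (s : sort Sg) (t : term s) : seq (var Sg) :=
  match t with
  | Var s n => [:: (s, n)]
  | App f ts => tsFV ts
  end
with tsFV (Sg : signature) (l : seq (sort Sg)) (ts : terms l) : seq (var Sg) :=
  match ts with
  | TNil => [::]
  | TCons _ _ t ts => tFV t ++ tsFV ts
  end.

Fixpoint FV (Sg : signature) (A : formula Sg) : seq (var Sg) :=
  match A with
  | Top | Bot => [::]
  | Rel r ts => tsFV ts
  | And A B | Or A B | Imp A B => FV A ++ FV B
  | All x A | Ex x A => [seq y <- FV A | y != x]
  end.

(* The sequence [y :: G] stands for the context "G, y": the variable declared
   last comes first. *)
Definition ctx (Sg : signature) : Type := seq (var Sg).

Definition declares (Sg : signature) (G : ctx Sg) (l : seq (var Sg)) : bool :=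
  all (mem G) l.

Definition FVctx (Sg : signature) (A : formula Sg) : ctx Sg := undup (FV A).
Definition FVctx2 (Sg : signature) (A B : formula Sg) : ctx Sg :=
  undup (FV A ++ FV B).

Record sequent (Sg : signature) := Sequent {
  antecedent : formula Sg;
  seq_ctx : ctx Sg;
  succedent : formula Sg;
  seq_ctx_uniq : uniq seq_ctx;
  seq_ctx_FV : declares seq_ctx (FV antecedent ++ FV succedent) }.

(** Capture-avoiding substitution: a bound variable is renamed only when it
    occurs free in one of the terms substituted below it. *)

Definition substitution (Sg : signature) : Type := forall x : var Sg, term x.1.

Fixpoint tsubst (Sg : signature) (sg : substitution Sg) (s : sort Sg)
  (t : term s) : term s :=
  match t in term s return term s with
  | Var s n => sg (s, n)
  | App f ts => App (tssubst sg ts)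
  end
with tssubst (Sg : signature) (sg : substitution Sg) (l : seq (sort Sg))
  (ts : terms l) : terms l :=
  match ts in terms l return terms l with
  | TNil => TNil Sg
  | TCons _ _ t ts => TCons (tsubst sg t) (tssubst sg ts)
  end.

Definition upd (Sg : signature) (sg : substitution Sg) (x : var Sg)
  (t : term x.1) : substitution Sg :=
  fun y => if @eqP _ x y is ReflectT e then
             ecast z (term z.1) e t
           else sg y.

Definition fresh (Sg : signature) (x : var Sg) (l : seq (var Sg)) : nat :=
  if x \in l then (\max_(y <- l) y.2).+1 else x.2.

Definition subst_bound (Sg : signature) (sg : substitution Sg) (x : var Sg)
  (A : formula Sg) : nat :=
  fresh x (flatten [seq tFV (sg y) | y <- [seq y <- FV A | y != x]]).

Fixpoint subst (Sg : signature) (sg : substitution Sg) (A : formula Sg) :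
  formula Sg :=
  match A with
  | Top => Top
  | Bot => Bot
  | Rel r ts => Rel (tssubst sg ts)
  | And A B => And (subst sg A) (subst sg B)
  | Or A B => Or (subst sg A) (subst sg B)
  | Imp A B => Imp (subst sg A) (subst sg B)
  | All x A => let n := subst_bound sg x A in
      All ((x.1, n) : var Sg) (subst (upd sg (x := x) (Var x.1 n)) A)
  | Ex x A => let n := subst_bound sg x A in
      Ex ((x.1, n) : var Sg) (subst (upd sg (x := x) (Var x.1 n)) A)
  end.

Definition subst1 (Sg : signature) (x : var Sg) (t : term x.1)
  (A : formula Sg) : formula Sg :=
  subst (upd (@vterm Sg) t) A.

(** * Structures and the interpretation of terms and formulae *)

Fixpoint iprod (C : category) (P : products C) (l : seq C) : C :=
  if l is a :: l then prd P (iprod P l) a else one P.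

Record hstructure (Sg : signature) (C : heyting_category) := HStructure {
  Msort : sort Sg -> C;
  Mfunc : forall f : func Sg,
    hom (iprod (hprod C) (map Msort (fdom f))) (Msort (fcod f));
  Mrel : forall r : rel_sym Sg, sub (iprod (hprod C) (map Msort (rdom r))) }.

Lemma declares_cat (Sg : signature) (G : ctx Sg) (l1 l2 : seq (var Sg)) :
  declares G (l1 ++ l2) -> declares G l1 /\ declares G l2.
Proof. by rewrite /declares all_cat => /andP. Qed.

Lemma declares_binder (Sg : signature) (G : ctx Sg) (x : var Sg)
  (l : seq (var Sg)) :
  declares G [seq y <- l | y != x] -> declares (x :: G) l.
Proof.
move=> /allP H; apply/allP => y yl; rewrite /= inE.
by case: eqVneq => //= nyx; apply: H; rewrite mem_filter nyx.
Qed.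

Lemma declares1 (Sg : signature) (G : ctx Sg) (x : var Sg) :
  declares G [:: x] -> x \in G.
Proof. by rewrite /declares /= andbT. Qed.

Lemma in_tail (T : eqType) (x y : T) (l : seq T) :
  x <> y -> x \in y :: l -> x \in l.
Proof. by move=> /eqP/negPf nxy; rewrite inE nxy. Qed.

Lemma in_absurd (T : eqType) (x : T) : x \in [::] -> False.
Proof. by []. Qed.

Section Interpretation.
Variables (Sg : signature) (C : heyting_category) (M : hstructure Sg C).

Definition Mctx (G : ctx Sg) : C :=
  iprod (hprod C) [seq Msort M x.1 | x <- G].

(* A repeated variable refers to its latest declaration.  Hence a quantifier
   rebinding a variable of the context shadows it, which interprets the formula
   in the same way as after renaming the bound variable. *)
Fixpoint proj (G : ctx Sg) (x : var Sg) :
  x \in G -> hom (Mctx G) (Msort M x.1) :=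
  match G return x \in G -> hom (Mctx G) (Msort M x.1) with
  | [::] => fun H => False_rect _ (in_absurd H)
  | y :: G => fun H =>
      match @eqP _ x y with
      | ReflectT e =>
          ecast z (hom (Mctx (y :: G)) (Msort M z.1)) (esym e)
            (psnd (hprod C) (Mctx G) (Msort M y.1))
      | ReflectF n =>
          proj (in_tail n H) \oc pfst (hprod C) (Mctx G) (Msort M y.1)
      end
  end.

Fixpoint interp_term (G : ctx Sg) (s : sort Sg) (t : term s) :
  declares G (tFV t) -> hom (Mctx G) (Msort M s) :=
  match t in term s return declares G (tFV t) -> hom (Mctx G) (Msort M s) with
  | Var s n => fun H => proj (declares1 H)
  | App f ts => fun H => Mfunc M f \oc interp_terms (G := G) (ts := ts) H
  end
with interp_terms (G : ctx Sg) (l : seq (sort Sg)) (ts : terms l) :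
  declares G (tsFV ts) -> hom (Mctx G) (iprod (hprod C) (map (Msort M) l)) :=
  match ts in terms l
    return declares G (tsFV ts) -> hom (Mctx G) (iprod (hprod C) (map (Msort M) l)) with
  | TNil => fun _ => bang (hprod C) (Mctx G)
  | TCons s l t ts => fun H =>
      ppair (hprod C) (interp_terms (declares_cat H).2)
                      (interp_term (declares_cat H).1)
  end.

Fixpoint interp (G : ctx Sg) (A : formula Sg) :
  declares G (FV A) -> sub (Mctx G) :=
  match A return declares G (FV A) -> sub (Mctx G) with
  | Top => fun _ => sub_top (Mctx G)
  | Bot => fun _ => sub_bot (Mctx G)
  | Rel r ts => fun H =>
      sub_pb (hpb C) (interp_terms (G := G) (ts := ts) H) (Mrel M r)
  | And A B => fun H => sub_meet (hpb C) (interp (declares_cat H).1)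
                                         (interp (declares_cat H).2)
  | Or A B => fun H => sub_join (interp (declares_cat H).1)
                                (interp (declares_cat H).2)
  | Imp A B => fun H => sub_imp (interp (declares_cat H).1)
                                (interp (declares_cat H).2)
  | All x A => fun H => sub_forall (pfst (hprod C) (Mctx G) (Msort M x.1))
      (interp (G := x :: G) (declares_binder H))
  | Ex x A => fun H => sub_exists (pfst (hprod C) (Mctx G) (Msort M x.1))
      (interp (G := x :: G) (declares_binder H))
  end.

Definition H_valid (q : sequent Sg) : Prop :=
  sub_le (interp (declares_cat (seq_ctx_FV q)).1)
         (interp (declares_cat (seq_ctx_FV q)).2).

End Interpretation.

Lemma declares_FVctx (Sg : signature) (A : formula Sg) :
  declares (FVctx A) (FV A).
Proof. by apply/allP => x; rewrite /= mem_undup. Qed.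

Lemma declares_FVctx2 (Sg : signature) (A B : formula Sg) :
  declares (FVctx2 A B) (FV A ++ FV B).
Proof. by apply/allP => x; rewrite /= mem_undup. Qed.

(** * Logically distributive categories

    A category with an interpretation [N] of formulae as objects.  It has
    finite products, finite coproducts and exponentials, and products distribute
    over coproducts; [N] maps connectives to these constructions up to
    isomorphism.  [N (All x A)] is terminal among the objects [N B], with [x]
    not free in [B], equipped with a cone over the family [N (A[t/x])] indexed
    by all terms [t] of the sort of [x]; [N (Ex x A)] is dually initial. *)

Section LogicallyDistributive.
Variables (Sg : signature) (D : category) (N : formula Sg -> D).

Definition cone (x : var Sg) (A : formula Sg) (a : D) : Type :=
  forall t : term x.1, hom a (N (subst1 t A)).

Definition cocone (x : var Sg) (A : formula Sg) (a : D) : Type :=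
  forall t : term x.1, hom (N (subst1 t A)) a.

Definition distr (P : products D) (Q : coproducts D) (a b c : D) :
  hom (cprd Q (prd P a b) (prd P a c)) (prd P a (cprd Q b c)) :=
  copair Q (prd_map P (idc a) (inj1 Q b c)) (prd_map P (idc a) (inj2 Q b c)).

Record logically_distributive := LogicallyDistributive {
  ld_prod : products D;
  ld_coprod : coproducts D;
  ld_expo : exponentials ld_prod;
  ld_distr : forall a b c, is_iso (distr ld_prod ld_coprod a b c);
  ld_Top : isom (N Top) (one ld_prod);
  ld_Bot : isom (N Bot) (zero ld_coprod);
  ld_And : forall A B, isom (N (And A B)) (prd ld_prod (N A) (N B));
  ld_Or : forall A B, isom (N (Or A B)) (cprd ld_coprod (N A) (N B));
  ld_Imp : forall A B, isom (N (Imp A B)) (expo ld_expo (N A) (N B));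
  ld_All : forall x A, exists p : cone x A (N (All x A)),
    forall B, x \notin FV B -> forall q : cone x A (N B),
    exists! h : hom (N B) (N (All x A)), forall t, p t \oc h = q t;
  ld_Ex : forall x A, exists p : cocone x A (N (Ex x A)),
    forall B, x \notin FV B -> forall q : cocone x A (N B),
    exists! h : hom (N (Ex x A)) (N B), forall t, h \oc p t = q t;
  ld_Ex_And : forall x A B, x \notin FV A ->
    isom (N (Ex x (And A B))) (prd ld_prod (N A) (N (Ex x B))) }.

End LogicallyDistributive.

(** * The category LD(M) *)

Section LD.
Variables (Sg : signature) (C : heyting_category) (M : hstructure Sg C).

(* The object given by [[FV(A). A]] is labelled by [A], since the arrows depend
   on [A] and not just on that sub-object: [P(x)] and [P(y)] determine the same
   sub-object, but in the context [x, y] neither need be below the other. *)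
Record LD_obj := LDObj { LD_label : formula Sg }.

Definition LD_sub (X : LD_obj) : sub (Mctx M (FVctx (LD_label X))) :=
  interp M (declares_FVctx (LD_label X)).

Definition LD_hom (X Y : LD_obj) : Prop :=
  sub_le (interp M (declares_cat (declares_FVctx2 (LD_label X) (LD_label Y))).1)
         (interp M (declares_cat (declares_FVctx2 (LD_label X) (LD_label Y))).2).

Definition LD_transitive : Prop :=
  forall X Y Z, LD_hom X Y -> LD_hom Y Z -> LD_hom X Z.

Lemma declares_irr (G : ctx Sg) (l : seq (var Sg)) (H K : declares G l) : H = K.
Proof. exact: bool_irrelevance. Qed.

Lemma LD_hom_refl (X : LD_obj) : LD_hom X X.
Proof.
rewrite /LD_hom; set H := _.1; set K := _.2.
by rewrite (declares_irr H K); apply: sub_le_refl.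
Qed.

Definition LD_category (tr : LD_transitive) : category :=
  {| obj := LD_obj;
     hom := LD_hom;
     idc := LD_hom_refl;
     cmp := fun X Y Z g f => tr X Y Z f g;
     cmp1c := fun _ _ _ => proof_irrelevance _ _ _;
     cmpc1 := fun _ _ _ => proof_irrelevance _ _ _;
     cmpA := fun _ _ _ _ _ _ _ => proof_irrelevance _ _ _ |}.

(* The objects, arrows and interpretation map of LD(M) are determined by M; an
   element of [LD] is the evidence that they do form a logically distributive
   category.  This is not automatic: if the object interpreting some sort s is
   not well supported (in sets: empty), then the arrows may fail to compose and
   [All x A -> A], with [x] a variable of sort s that is not free in [A], may
   fail to be an arrow. *)
Record LD := MkLD {
  LD_trans : LD_transitive;
  LD_cat := LD_category LD_trans;
  LD_map : formula Sg -> LD_cat := LDObj;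
  LD_ld : logically_distributive LD_map }.

Definition LD_valid (L : LD) (q : sequent Sg) : Prop :=
  inhabited (hom (LD_map L (antecedent q)) (LD_map L (succedent q))).

End LD.

(* Main.v *)
From mathcomp Require Import all_boot.
Require Import Defs.

Set Implicit Arguments.
Unset Strict Implicit.
Unset Printing Implicit Defensive.

(** Validity in [M] is an inequality of sub-objects in the context of the
    sequent, validity in LD(M) is the same inequality in the context of the
    free variables only.  So the theorem says that validity does not depend on
    the variables which a context declares beyond the free ones.

    Sub-objects are compared through their generalised elements: [m] is below
    [n] when every arrow that factors through [m] factors through [n]
    ([sub_leP]).  The Kripke-Joyal clauses ([factors_exists], [factors_forall],
    [factors_imp], [factors_join], [factors_bot]) then describe the elements
    of an interpreted formula, and give by induction a coincidence lemma
    ([interp_agree]): whether a generalised element satisfies a formula depends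
    only on its components at the free variables.  In this form neither the
    Beck-Chevalley conditions nor the Frobenius law have to be stated for the
    interpretation: they are contained in the stability of covers.

    Coincidence makes entailment survive any enlargement of the context
    ([entails_weaken]), which is the passage from LD(M) to [M].  In the opposite
    direction a variable [x] that is not free has to be discarded, which can
    fail in a general structure because the sort of [x] may be empty.  But
    entailment of [B] from [A] in the larger context gives entailment of
    [All x B] from [A] in the smaller one, and since LD(M) is logically
    distributive, the universal cone has a component [All x B -> B] at the term
    [x] ([LD_all_elim]). *)

(** * Generalised elements of sub-objects *)

Section Elements.
Variable C : heyting_category.
Implicit Types a b c : C.

Lemma factors_cmp a b c (f : hom b c) (g : hom a b) (m : sub c) :
  factors f m -> factors (f \oc g) m.
Proof. by move=> [u <-]; exists (u \oc g); rewrite cmpA. Qed.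

Lemma sub_leP a (m n : sub a) :
  sub_le m n <-> forall c (f : hom c a), factors f m -> factors f n.
Proof.
split=> [mn c f fm | H]; first exact: factors_le mn.
by apply: H; exists (idc _); rewrite cmpc1.
Qed.

(** The pullback of [m] along [f] receives the cover, so it is everything. *)
Lemma factors_local a b c (e : hom a b) (f : hom b c) (m : sub c) :
  cover e -> factors (f \oc e) m -> factors f m.
Proof.
move=> ce /(factors_pb (hpb C)) /ce /(factors_pb (hpb C)) /=.
by rewrite cmpc1.
Qed.

(** By minimality of the image: a sub-object through which the corestriction
    factors is also a sub-object of [b] through which [f] factors. *)
Lemma image_cover a b (f : hom a b) :
  exists2 g : hom a (sdom (image f)), smap (image f) \oc g = f & cover g.
Proof.
have [g eg] := image_factors f; exists g => // m [u eu].
have fm : factors f (Sub (cmp_mono (smap_mono (s := image f))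
                                   (smap_mono (s := m)))).
  by exists u; rewrite -[RHS]eg -eu /= cmpA.
have [v ev] := image_least fm; exists v; apply: (smap_mono (s := image f)).
by rewrite cmpA /= cmpc1.
Qed.

(** Clause for the existential quantifier.  An element of the image need not
    lift to [m], but it does after pulling back the cover of the image. *)
Lemma factors_exists a b c (g : hom a b) (m : sub a) (f : hom c b) :
  factors f (sub_exists g m) <->
  exists d (e : hom d c) (k : hom d a),
    [/\ cover e, factors k m & g \oc k = f \oc e].
Proof.
split=> [[u eu] | [d [e [k [ce [v ev] ek]]]]].
  have [w ew cw] := image_cover (g \oc smap m).
  exists _, (pb2 (hpb C) w u), (smap m \oc pb1 (hpb C) w u); split.
  - exact: cover_pb cw.
  - by exists (pb1 (hpb C) w u).
  rewrite cmpA -eu -[RHS]cmpA -pb_comm cmpA.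
  exact: (congr1 (fun h => h \oc pb1 (hpb C) w u) (esym ew)).
apply: (factors_local ce); rewrite -ek -ev cmpA.
exact/factors_cmp/image_factors.
Qed.

(** Clause for the universal quantifier.  The adjunction only speaks of
    sub-objects, so the element [f] is first replaced by its image. *)
Lemma factors_forall a b c (g : hom a b) (m : sub a) (f : hom c b) :
  factors f (sub_forall g m) <->
  forall d (t : hom d a) (u : hom d c), g \oc t = f \oc u -> factors t m.
Proof.
split=> [fm d t u e | H].
  have le_im : sub_le (image f) (sub_forall g m) := image_least fm.
  have /sub_leP := (sub_forall_adj _ _ _).2 le_im; apply.
  by apply/factors_pb; rewrite e; apply/factors_cmp/image_factors.
apply: (factors_le (image_factors f)); apply/sub_forall_adj/sub_leP => d t.
(* An element of the image of [f] lifts to an element of [c] only after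
   passing to a cover. *)
move=> /factors_pb [v ev]; have [w ew cw] := image_cover f.
apply: (factors_local (cover_pb (g := v) cw)).
apply: (H _ _ (pb1 (hpb C) w v)).
by rewrite cmpA -ev -cmpA -pb_comm cmpA ew.
Qed.

Lemma factors_meet a c (m n : sub a) (f : hom c a) :
  factors f (sub_meet (hpb C) m n) <-> factors f m /\ factors f n.
Proof.
have [lem len] := (sub_meet_glb (hpb C) m n _).1 (sub_le_refl _).
split=> [fmn | [/image_least fm /image_least fn]].
  by split; [apply: factors_le lem | apply: factors_le len].
by apply: (factors_le (image_factors f)); apply/sub_meet_glb.
Qed.

Lemma factors_imp a c (m n : sub a) (f : hom c a) :
  factors f (sub_imp m n) <->
  forall d (u : hom d c), factors (f \oc u) m -> factors (f \oc u) n.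
Proof.
split=> [/factors_forall H d u [v ev] | H].
  by rewrite -ev; apply/(factors_pb (hpb C))/(H _ _ u).
apply/factors_forall => d t u e; apply/factors_pb; rewrite e.
by apply: H; rewrite -e; exists t.
Qed.

Lemma sub_pb_mono a b (f : hom a b) (m n : sub b) :
  sub_le m n -> sub_le (sub_pb (hpb C) f m) (sub_pb (hpb C) f n).
Proof.
move=> mn; apply/sub_leP => c g /factors_pb gm; apply/factors_pb.
exact: factors_le mn.
Qed.

(** Clauses for disjunction and falsity.  By stability under pullback, both
    are decided in the lattice of sub-objects of the domain of the element. *)
Lemma factors_join a c (m n : sub a) (f : hom c a) :
  factors f (sub_join m n) <->
  sub_le (sub_top c)
    (sub_join (sub_pb (hpb C) f m) (sub_pb (hpb C) f n)).
Proof.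
have [jm jn] := (sub_join_lub _ _ _).1 (sub_le_refl (sub_join m n)).
split=> [fmn | H].
  apply: sub_le_trans (sub_join_pb _ _ _).
  by apply/sub_le_pb; rewrite /= cmpc1.
rewrite -[f]cmpc1; apply/(sub_le_pb _ _ (sub_top c)).
by apply: (sub_le_trans H); apply/sub_join_lub; split; apply: sub_pb_mono.
Qed.

Lemma factors_bot a c (f : hom c a) :
  factors f (sub_bot a) <-> sub_le (sub_top c) (sub_bot c).
Proof.
split=> H.
  apply: sub_le_trans (sub_bot_pb f).
  by apply/sub_le_pb; rewrite /= cmpc1.
rewrite -[f]cmpc1; apply/(sub_le_pb (hpb C) _ (sub_top c)).
exact: sub_le_trans H (sub_bot_least _).
Qed.

End Elements.

(** * Dependence on the context *)

Section Contexts.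
Variables (Sg : signature) (C : heyting_category) (M : hstructure Sg C).
Implicit Types (G : ctx Sg) (A B : formula Sg) (x y : var Sg).

Definition agree (l : seq (var Sg)) T G G'
  (f : hom T (Mctx M G)) (f' : hom T (Mctx M G')) : Prop :=
  forall x, x \in l -> forall (H : x \in G) (H' : x \in G'),
  proj M H \oc f = proj M H' \oc f'.

Lemma agree_sym l T G G' (f : hom T (Mctx M G)) (f' : hom T (Mctx M G')) :
  agree l f f' -> agree l f' f.
Proof. by move=> ag x xl H H'; rewrite (ag x xl H' H). Qed.

Lemma agree_sub l l' T G G' (f : hom T (Mctx M G)) (f' : hom T (Mctx M G')) :
  {subset l' <= l} -> agree l f f' -> agree l' f f'.
Proof. by move=> sl ag x /sl; apply: ag. Qed.

Lemma agree_cat l l' T G G' (f : hom T (Mctx M G)) (f' : hom T (Mctx M G')) :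
  agree (l ++ l') f f' -> agree l f f' /\ agree l' f f'.
Proof.
by move=> ag; split; apply: agree_sub ag => x xl; rewrite mem_cat xl ?orbT.
Qed.

Lemma agree_cmp l S T G G' (f : hom T (Mctx M G)) (f' : hom T (Mctx M G'))
  (u : hom S T) :
  agree l f f' -> agree l (f \oc u) (f' \oc u).
Proof. by move=> ag x xl H H'; rewrite !cmpA (ag x xl H H'). Qed.

Lemma proj_head G x (H : x \in x :: G) :
  proj M H = psnd (hprod C) (Mctx M G) (Msort M x.1).
Proof.
by rewrite /=; case: eqP => // e; rewrite (eq_irrelevance e (erefl x)).
Qed.

Lemma proj_tail G x y (H : x \in y :: G) (H' : x \in G) :
  x <> y -> proj M H = proj M H' \oc pfst (hprod C) (Mctx M G) (Msort M y.1).
Proof.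
by move=> nxy /=; case: eqP => // n; rewrite (bool_irrelevance (in_tail n H) H').
Qed.

(** Under a binder only the variables other than the bound one must already
    agree, so contexts that happen to declare the bound variable differently
    cause no trouble. *)
Lemma agree_binder l x T G G' (f : hom T (Mctx M (x :: G)))
  (f' : hom T (Mctx M (x :: G'))) :
  declares G [seq y <- l | y != x] -> declares G' [seq y <- l | y != x] ->
  agree [seq y <- l | y != x]
    (pfst (hprod C) (Mctx M G) (Msort M x.1) \oc f)
    (pfst (hprod C) (Mctx M G') (Msort M x.1) \oc f') ->
  psnd (hprod C) (Mctx M G) (Msort M x.1) \oc f =
    psnd (hprod C) (Mctx M G') (Msort M x.1) \oc f' ->
  agree l f f'.
Proof.
move=> /allP D /allP D' ag es y yl H H'; have [eyx|/eqP nyx] := eqVneq y x.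
  by move: H H'; rewrite {}eyx => H H'; rewrite !proj_head.
have yl' : y \in [seq y <- l | y != x] by rewrite mem_filter yl andbT; apply/eqP.
rewrite (proj_tail H (D _ yl') nyx) (proj_tail H' (D' _ yl') nyx) -!cmpA.
exact: ag.
Qed.

Scheme term_mut := Induction for term Sort Prop
with terms_mut := Induction for terms Sort Prop.

Lemma interp_terms_agree ls (ts : terms (Sg := Sg) ls) T G G'
  (f : hom T (Mctx M G)) (f' : hom T (Mctx M G'))
  (H : declares G (tsFV ts)) (H' : declares G' (tsFV ts)) :
  agree (tsFV ts) f f' ->
  interp_terms M H \oc f = interp_terms M H' \oc f'.
Proof.
move: ls ts H H'.
apply: (@terms_mut Sg (fun s t => forall (H : declares G (tFV t))
  (H' : declares G' (tFV t)), agree (tFV t) f f' ->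
  interp_term M H \oc f = interp_term M H' \oc f')).
- by move=> s n H H' ag /=; apply: (ag (s, n)); rewrite inE.
- by move=> g ts IH H H' ag /=; rewrite -!cmpA (IH H H').
- by move=> H H' ag; apply: bang_uniq.
move=> s l t IHt ts IHts H H' /= /agree_cat [agt agts].
apply: ppair_uniq; rewrite !cmpA.
  by rewrite !pfst_pair; apply: IHts.
by rewrite !psnd_pair; apply: IHt.
Qed.

(** Coincidence lemma.  The statement is symmetric in the two elements, so one
    implication suffices; implication in its clause uses it both ways. *)
Lemma interp_agree A T G G' (f : hom T (Mctx M G)) (f' : hom T (Mctx M G'))
  (H : declares G (FV A)) (H' : declares G' (FV A)) :
  agree (FV A) f f' -> factors f (interp M H) -> factors f' (interp M H').
Proof.
elim: A T G G' f f' H H' =>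
    [||r ts|A IHA B IHB|A IHA B IHB|A IHA B IHB|x A IH|x A IH]
    T G G' f f' H H' /=.
- by move=> _ _; exists f'; rewrite /= cmp1c.
- by move=> _ /factors_bot Hb; apply/factors_bot.
- move=> ag /factors_pb Hr; apply/factors_pb.
  by rewrite -(interp_terms_agree H H' ag).
- move=> /agree_cat [agA agB] /factors_meet [fA fB]; apply/factors_meet.
  by split; [apply: IHA fA | apply: IHB fB].
- move=> /agree_cat [agA agB] /factors_join fAB; apply/factors_join.
  apply: (sub_le_trans fAB); move: (sub_le_refl
    (sub_join (sub_pb (hpb C) f' (interp M (declares_cat H').1))
              (sub_pb (hpb C) f' (interp M (declares_cat H').2)))).
  move=> /sub_join_lub [leA leB]; apply/sub_join_lub; split.
    apply: sub_le_trans leA; apply/sub_leP => S u /factors_pb fu.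
    by apply/factors_pb; apply: IHA fu; apply: agree_cmp.
  apply: sub_le_trans leB; apply/sub_leP => S u /factors_pb fu.
  by apply/factors_pb; apply: IHB fu; apply: agree_cmp.
- move=> /agree_cat [agA agB] /factors_imp fAB; apply/factors_imp => S u fA.
  apply: (IHB _ _ _ (f \oc u) _ (declares_cat H).2); first exact: agree_cmp.
  by apply: fAB; apply: IHA fA; apply/agree_cmp/agree_sym.
- move=> ag /factors_forall fA; apply/factors_forall => S t u et.
  (* Keep the [x]-component of [t], but put it over [f] instead of [f']. *)
  pose t0 : hom S (Mctx M (x :: G)) := ppair (hprod C) (f \oc u)
               (psnd (hprod C) (Mctx M G') (Msort M x.1) \oc t).
  apply: (IH _ _ _ t0 _ (declares_binder H)).
    2: by apply: (fA _ _ u); rewrite pfst_pair.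
  apply: agree_binder; rewrite ?pfst_pair ?psnd_pair ?et //.
  exact: agree_cmp.
move=> ag /factors_exists [S [e [k [ce kA ek]]]].
apply/factors_exists; exists S, e, (ppair (hprod C) (f' \oc e)
  (psnd (hprod C) (Mctx M G) (Msort M x.1) \oc k)).
split; rewrite ?pfst_pair //; apply: IH kA.
apply: agree_binder; rewrite ?pfst_pair ?psnd_pair ?ek //.
exact: agree_cmp.
Qed.

(** The tuple of the projections that [G'] names; this is the arrow along which
    formulae in context [G'] are weakened to [G]. *)
Lemma agree_restrict G G' T (f : hom T (Mctx M G)) :
  {subset G' <= G} -> exists f' : hom T (Mctx M G'), agree G' f f'.
Proof.
elim: G' => [|y G' IH] sG; first by exists (bang (hprod C) T).
have [|f' ag] := IH; first by move=> x xG; apply: sG; rewrite inE xG orbT.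
have yG : y \in G by apply: sG; rewrite inE eqxx.
exists (ppair (hprod C) f' (proj M yG \oc f)) => x _ H H'.
have [exy|/eqP nxy] := eqVneq x y.
  move: H H'; rewrite {}exy => H H'.
  by rewrite proj_head psnd_pair (bool_irrelevance H yG).
have xG' := in_tail nxy H'.
by rewrite (proj_tail H' xG' nxy) -cmpA pfst_pair; apply: ag.
Qed.

(** * Entailment in a context *)

(** Quantifying over the evidence that the formulae are in context keeps it out
    of the statements; any choice gives the same proposition ([entailsE]). *)
Definition entails G A B : Prop :=
  forall (H : declares G (FV A)) (K : declares G (FV B)),
  sub_le (interp M H) (interp M K).

Lemma entailsE G A B (H : declares G (FV A)) (K : declares G (FV B)) :
  entails G A B <-> sub_le (interp M H) (interp M K).
Proof.
split=> [|le_HK H' K']; first exact.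
by rewrite (declares_irr H' H) (declares_irr K' K).
Qed.

Lemma entails_weaken G G' A B :
  declares G (FV A ++ FV B) -> {subset G <= G'} ->
  entails G A B -> entails G' A B.
Proof.
move=> /declares_cat [H K] sG /entailsE - /(_ H K) /sub_leP le_HK H' K'.
apply/sub_leP => T f' fA; have [f ag] := agree_restrict f' sG.
have agA : agree (FV A) f' f by apply: agree_sub ag => x /(allP H).
have agB : agree (FV B) f' f by apply: agree_sub ag => x /(allP K).
exact: interp_agree K' (agree_sym agB) (le_HK _ _ (interp_agree H agA fA)).
Qed.

(** An element of the larger context lying over one that satisfies [A] satisfies
    [A] too, because [A] does not depend on its [x]-component. *)
Lemma entails_all_intro G A B x :
  x \notin FV A -> declares G (FV A) ->
  entails (x :: G) A B -> entails G A (All x B).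
Proof.
move=> xA D EAB H K; apply/sub_leP => T f fA; apply/factors_forall => S t u et.
have Hx : declares (x :: G) (FV A).
  by apply/allP => y /(allP D) yG; rewrite /= inE [y \in G]yG orbT.
have /sub_leP := EAB Hx (declares_binder K); apply.
apply: interp_agree (factors_cmp u fA) => y yA Hy Hy'.
have nyx : y <> x by move=> eyx; rewrite -eyx yA in xA.
by rewrite (proj_tail Hy' Hy nyx) -cmpA et.
Qed.

Lemma LD_homE A B : LD_hom M (LDObj A) (LDObj B) <-> entails (FVctx2 A B) A B.
Proof. by split=> [|E]; [exact: (entailsE _ _).2 | apply: E]. Qed.

End Contexts.

(** * Substituting variables for themselves *)

Section IdentitySubstitution.
Variable Sg : signature.

Lemma tssubst_id (sg : substitution Sg) l (ts : terms l) :
  (forall y, sg y = vterm y) -> tssubst sg ts = ts.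
Proof.
move=> sgE; move: l ts.
apply: (@terms_mut Sg (fun s t => tsubst sg t = t)) => //=.
- by move=> s n; rewrite sgE.
- by move=> g ts ->.
by move=> s l t -> ts ->.
Qed.

Lemma upd_id (sg : substitution Sg) (x : var Sg) :
  (forall y, sg y = vterm y) -> forall y, upd sg (vterm x) y = vterm y.
Proof. by move=> sgE y; rewrite /upd; case: eqP => // e; case: _ / e. Qed.

(** No free variable other than [x] is mapped to a term containing [x]. *)
Lemma subst_bound_id (sg : substitution Sg) (x : var Sg) (A : formula Sg) :
  (forall y, sg y = vterm y) -> subst_bound sg x A = x.2.
Proof.
move=> sgE; rewrite /subst_bound /fresh ifN //; apply/negP => /flattenP [l].
move=> /mapP [y]; rewrite mem_filter => /andP [nyx _] -> {l}.
by rewrite sgE /= inE -surjective_pairing eq_sym (negPf nyx).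
Qed.

Lemma subst_id (sg : substitution Sg) (A : formula Sg) :
  (forall y, sg y = vterm y) -> subst sg A = A.
Proof.
elim: A sg => [||r ts|A IHA B IHB|A IHA B IHB|A IHA B IHB|x A IH|x A IH] sg sgE
  //=.
- by rewrite tssubst_id.
- by rewrite IHA ?IHB.
- by rewrite IHA ?IHB.
- by rewrite IHA ?IHB.
- by rewrite subst_bound_id // IH -?surjective_pairing //; apply: upd_id.
by rewrite subst_bound_id // IH -?surjective_pairing //; apply: upd_id.
Qed.

End IdentitySubstitution.

(** * Discarding variables in LD(M) *)

Section Discard.
Variables (Sg : signature) (C : heyting_category) (M : hstructure Sg C).
Variable L : LD M.
Implicit Types (G : ctx Sg) (A B : formula Sg) (x : var Sg).

(** The component at the term [x] of the universal cone over the instances of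
    [A].  This is where logical distributivity enters: it is what rules out
    the effect of a badly supported sort. *)
Lemma LD_all_elim x A : entails M (FVctx2 (All x A) A) (All x A) A.
Proof.
have [p _] := ld_All (LD_ld L) x A; have := p (vterm x).
by rewrite /subst1 subst_id; [move/LD_homE | exact: upd_id].
Qed.

(** Cut on [All x B].  The variable [x] may be free in [B]: instantiation at [x]
    itself does not disturb it. *)
Lemma entails_strengthen G A B x :
  declares G (FV A ++ FV B) -> x \notin FV A ->
  entails M (x :: G) A B -> entails M G A B.
Proof.
move=> D xA EAB H K.
have DAll : declares G (FV (All x B)).
  by apply/allP => y; rewrite mem_filter => /andP [_ /(allP K)].
have AllB : entails M G (All x B) B.
  apply: (entails_weaken _ _ (@LD_all_elim x B)); first exact: declares_FVctx2.
  move=> y; rewrite mem_undup mem_cat => /orP [/(allP DAll)|/(allP K)] //.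
exact: sub_le_trans (entails_all_intro xA H EAB H DAll) (AllB DAll K).
Qed.

Lemma entails_discard E G A B :
  declares G (FV A ++ FV B) -> entails M (E ++ G) A B -> entails M G A B.
Proof.
move=> D; elim: E => //= x E IH EAB; apply: IH.
have DE : declares (E ++ G) (FV A ++ FV B).
  by apply/allP => y /(allP D) yG; rewrite /= mem_cat [y \in G]yG orbT.
have [xA|xA] := boolP (x \in FV A); last exact: entails_strengthen EAB.
(* A free variable of [A] is declared again in [G], so the context only
   loses a repetition. *)
apply: (entails_weaken _ _ EAB) => [|y].
  by apply/allP => y /(allP DE) yG; rewrite /= inE [y \in _]yG orbT.
rewrite inE => /orP [/eqP ->|//]; apply: (allP DE).
by rewrite mem_cat xA.
Qed.

End Discard.

Theorem corollary8p15 (Sg : signature) (C : heyting_category)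
  (M : hstructure Sg C) (L : LD M) (q : sequent Sg) :
  H_valid M q <-> LD_valid L q.
Proof.
have D := seq_ctx_FV q; have D2 := declares_FVctx2 (antecedent q) (succedent q).
split=> [Hq | [/LD_homE Hq]].
  apply/inhabits/LD_homE/(entails_discard L (E := seq_ctx q) D2).
  apply: (entails_weaken D) => [x xq|]; first by rewrite mem_cat xq.
  exact: (entailsE M _ _).2 Hq.
apply: (entails_weaken D2 _ Hq) => x.
by rewrite mem_undup => /(allP D).
Qed.
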